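(* Let $\mathbb D$ be the countable random poset. For each $\mathbb R$-embeddable complete linear order $L$ whose least element $0_L$ is non-isolated, there is a maximal chain in the poset $\langle\mathbb P(\mathbb D)\cup\{\emptyset\},\subset\rangle$ isomorphic to $L$.
   Context: The countable random poset $\mathbb D=\langle D,<\rangle$ is the unique countable homogeneous universal strict partial order (the Fraïssé limit of finite partial orders). $\mathbb P(\mathbb D)$ is the set of $A\subset D$ whose induced suborder is isomorphic to $\mathbb D$. A linear order is complete if it has a least element $0_L$, a greatest element and no gaps; $0_L$ is non-isolated if it has no immediate successor; $\mathbb R$-embeddable means embeddable into $\langle\mathbb R,<\rangle$. *)

(* Defs.v *)
From HB Require Import structures.
From mathcomp Require Import all_boot all_order all_algebra.
From mathcomp Require Import boolp classical_sets functions cardinality reals.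
Set Implicit Arguments.
Unset Strict Implicit.
Unset Printing Implicit Defensive.
Import Order.TTheory.
Local Open Scope order_scope.
Local Open Scope classical_set_scope.

Section Relations.
Variables T U : Type.
Implicit Types (r : T -> T -> Prop) (s : U -> U -> Prop) (f : T -> U).

Definition is_embedding r s f :=
  injective f /\ forall x y, r x y <-> s (f x) (f y).

Definition embeddable r s := exists f, is_embedding r s f.

Definition is_isomorphism r s f :=
  bijective f /\ forall x y, r x y <-> s (f x) (f y).

Definition isomorphic r s := exists f, is_isomorphism r s f.
End Relations.

Definition induced (T : Type) (r : T -> T -> Prop) (A : set T) : A -> A -> Prop :=
  fun x y => r (val x) (val y).
Arguments induced {T} r A.

Definition strict_order (d : Order.disp_t) (T : porderType d) : T -> T -> Prop :=
  fun x y => x < y.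
Arguments strict_order {d} T.

Definition homogeneous (d : Order.disp_t) (D : porderType d) :=
  forall (A B : set D) (f : A -> B), finite_set A ->
    is_isomorphism (induced (strict_order D) A) (induced (strict_order D) B) f ->
    exists2 g : D -> D, is_isomorphism (strict_order D) (strict_order D) g &
      forall x : A, g (val x) = val (f x).

Definition universal (d : Order.disp_t) (D : porderType d) :=
  forall (d' : Order.disp_t) (P : porderType d'),
    countable [set: P] -> embeddable (strict_order P) (strict_order D).

(* These properties determine D up to isomorphism. *)
Definition random_poset (d : Order.disp_t) (D : porderType d) :=
  [/\ countable [set: D], homogeneous D & universal D].
Arguments random_poset {d} D.

Definition copies (d : Order.disp_t) (D : porderType d) : set (set D) :=
  [set A | isomorphic (induced (strict_order D) A) (strict_order D)].
Arguments copies {d} D.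

Section LinearOrders.
Variables (d : Order.disp_t) (L : tbOrderType d).

Definition is_gap (A B : set L) :=
  [/\ A !=set0 /\ B !=set0, A `|` B = setT,
      forall a b, A a -> B b -> a < b,
      ~ (exists2 m, A m & forall a, A a -> a <= m) &
      ~ (exists2 m, B m & forall b, B b -> m <= b)].

(* The least and greatest elements are part of the structure tbOrderType. *)
Definition complete_order := forall A B : set L, ~ is_gap A B.

Definition immediate_succ (x y : L) :=
  x < y /\ forall z, ~ (x < z /\ z < y).

(* The first conjunct excludes the one-point order: its only point has no
   immediate successor but is isolated in the order topology. *)
Definition bot_non_isolated :=
  (exists x : L, (\bot : L) < x) /\ ~ exists y : L, immediate_succ \bot y.
End LinearOrders.
Arguments complete_order {d} L.
Arguments bot_non_isolated {d} L.

Definition is_chain (T : Type) (P C : set (set T)) :=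
  C `<=` P /\ total_on C subset.

Definition is_maximal_chain (T : Type) (P C : set (set T)) :=
  is_chain P C /\ forall C', is_chain P C' -> C `<=` C' -> C' = C.

(* Main.v *)
(** Every level [x] of [L] gets the set [cut x] of those points of [D] whose rank
    lies below [x], for a bijection [rho] of [D] with a countable set [S] of levels:
    all immediate successors, and densely many right limits.  The bijection is
    generic (built by finite approximations) subject to: if [a < b] and [rho a] is
    not an immediate successor, then [rho a < rho b].  Genericity makes
    [cut x] realize all one-point types of [D], so [cut x] is a copy of [D].
    A set comparable with all cuts is a cut, or a cut together with one point
    whose rank is a right limit; that point is then maximal in the set, which
    therefore is not a copy of [D]. *)
Require Import Defs.
From HB Require Import structures.
From mathcomp Require Import all_boot all_order all_algebra.
From mathcomp Require Import boolp classical_sets functions cardinality reals.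
Set Implicit Arguments.
Unset Strict Implicit.
Unset Printing Implicit Defensive.
Import Order.TTheory.
Local Open Scope classical_set_scope.

(** * Generic sets from countably many dense requirements *)

Section Generic.
Variables (X : eqType) (K : countType) (J : Type) (Q : set J) (f : J -> K).
Variables (good : seq X -> Prop) (E : J -> seq X -> Prop).

(* Rasiowa-Sikorski: a generic set [G] meeting the countably many requirements [E]. *)
Lemma generic_set : {in Q &, injective f} -> good [::] ->
  (forall j p, Q j -> good p ->
     exists q, [/\ good q, {subset p <= q} & E j q]) ->
  exists G : set X,
    (forall s : seq X, (forall x, x \in s -> G x) ->
       exists2 p, good p & {subset s <= p} /\ forall x, x \in p -> G x) /\
    forall j, Q j ->
      exists2 p, good p & E j p /\ forall x, x \in p -> G x.
Proof.
move=> finj good0 dense.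
(* Goodness is assumed inside the existential, so that choice yields a total step function. *)
have stepP (np : nat * seq X) : exists q, good np.2 ->
    [/\ good q, {subset np.2 <= q} &
      forall j, Q j -> pickle (f j) = np.1 -> E j q].
  case: np => n p; have [gp|] := pselect (good p); last by exists p.
  have [[j Qj fj]|no] := pselect (exists2 j, Q j & pickle (f j) = n).
    have [q [gq pq Eq]] := dense j p Qj gp.
    exists q => _; split => // i Qi fi.
    suff -> : i = j by [].
    apply: finj; rewrite ?inE //.
    by apply: (pcan_inj pickleK); rewrite fi fj.
  exists p => _; split => // j Qj fj.
  by exfalso; apply: no; exists j.
have [step {}stepP] := choice stepP.
pose p := fix p n := if n is m.+1 then step (m, p m) else [::].
have gp n : good (p n).
  by elim: n => [|n gp] //=; case: (stepP (n, p n) gp).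
have pS n : {subset p n <= p n.+1} by case: (stepP (n, p n) (gp n)).
have ple m n : (m <= n)%N -> {subset p m <= p n}.
  move=> /subnK <-; elim: (n - m)%N => [|k IH] x //.
  by move=> /IH /pS.
exists [set x | exists n, x \in p n]; split => [s sG|j Qj].
  suff [n sn] : exists n, {subset s <= p n}.
    by exists (p n) => //; split=> // x xp; exists n.
  elim: s sG => [|x s IH] sG; first by exists 0.
  have [y ys|n sn] := IH; first by apply: sG; rewrite inE ys orbT.
  have [m xm] : exists n, x \in p n by apply: sG; rewrite inE eqxx.
  exists (maxn m n) => z; rewrite inE => /orP[/eqP->|/sn].
    exact: ple (leq_maxl m n) _ xm.
  exact: ple (leq_maxr m n) _.
(* The requirement with code [n] is met in passing from [p n] to [p n.+1]. *)
exists (p (pickle (f j)).+1); first exact: gp.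
split; last by move=> x xp; exists (pickle (f j)).+1.
by case: (stepP (pickle (f j), p (pickle (f j))) (gp _)) => _ _; apply.
Qed.

End Generic.

(** * Homogeneity in terms of finite lists of pairs *)

Section Homogeneous.
Local Open Scope order_scope.
Variables (d : Order.disp_t) (D : porderType d).

(** Finite partial isomorphisms are coded as lists of pairs, which can then serve as the finite
    approximations in [generic_set]. *)
Definition local_iso (s : seq (D * D)) := forall p q, p \in s -> q \in s ->
  ((p.1 == q.1) = (p.2 == q.2)) * ((p.1 < q.1) = (p.2 < q.2)).

(** The list is the graph of an isomorphism between the suborders on its first and second
    coordinates, to which homogeneity applies. *)
Lemma homogeneous_extension (s : seq (D * D)) : homogeneous D -> local_iso s ->
  exists g h : D -> D, [/\ cancel g h, cancel h g,
    forall x y, (g x < g y) = (x < y) & forall p, p \in s -> g p.1 = p.2].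
Proof.
move=> hom iso.
pose A := [set x | x \in unzip1 s]; pose B := [set x | x \in unzip2 s].
have fP (a : A) : exists b : B, (val a, val b) \in s.
  case: a => a /= aA; have /mapP[[x y] xys /= ->] := set_mem aA.
  have yB : y \in B by rewrite inE; apply/mapP; exists (x, y).
  by exists (SigSub yB).
have hP (b : B) : exists a : A, (val a, val b) \in s.
  case: b => b /= bB; have /mapP[[x y] xys /= ->] := set_mem bB.
  have xA : x \in A by rewrite inE; apply/mapP; exists (x, y).
  by exists (SigSub xA).
have [f {}fP] := choice fP; have [h {}hP] := choice hP.
have [||g [[h' gK h'K] gm] gf] := hom A B f.
- exact: finite_seq.
- split; last by move=> x y; rewrite /induced /strict_order (iso _ _ (fP x) (fP y)).2.
  exists h => x; apply: val_inj; apply/eqP.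
    by rewrite -[_ == _]/((val (h (f x)), val (f x)).1 == (val x, val (f x)).1)
       (iso _ _ (hP (f x)) (fP x)).1 eqxx.
  by rewrite -[_ == _]/((val (h x), val (f (h x))).2 == (val (h x), val x).2)
       -(iso _ _ (fP (h x)) (hP x)).1 eqxx.
exists g, h'; split => //.
  by move=> x y; apply/idP/idP => xy; [have := (gm x y).2 xy | have := (gm x y).1 xy].
move=> [x y] xys /=.
have xA : x \in A by rewrite inE; apply/mapP; exists (x, y).
have := gf (SigSub xA); rewrite /= => ->.
apply/eqP; rewrite -[_ == _]/((val (SigSub xA : A), val (f (SigSub xA))).2 == (x, y).2).
by rewrite -(iso _ _ (fP (SigSub xA)) xys).1 eqxx.
Qed.

End Homogeneous.

(** * Free one-point extensions and their realization *)

Section OnePointExtension.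
Local Open Scope order_scope.
Variables (d : Order.disp_t) (D : porderType d) (F : seq D) (z0 : D).

Definition one_point_ext := option D.
HB.instance Definition _ := Choice.copy one_point_ext (option D).

(** The least transitive relation that extends the order of [D] and gives the new point [None] the
    relations of [z0] to [F]. *)
Definition ext_lt (x y : one_point_ext) : bool :=
  match x, y with
  | Some x, Some y => x < y
  | Some x, None => has (fun f => (x <= f) && (f < z0)) F
  | None, Some y => has (fun f => (z0 < f) && (f <= y)) F
  | None, None => false
  end.

Lemma ext_lt_irr : irreflexive ext_lt.
Proof. by case=> [x|] //=; rewrite ltxx. Qed.

Lemma ext_lt_trans : transitive ext_lt.
Proof.
case=> [y|] [x|] [z|] //=.
- exact: lt_trans.
- move=> xy /hasP[f fF /andP[yf fz]]; apply/hasP; exists f => //.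
  by rewrite fz (ltW (lt_le_trans xy yf)).
- move=> /hasP[f fF /andP[yf fz]] xz; apply/hasP; exists f => //.
  by rewrite yf (le_trans fz (ltW xz)).
- move=> /hasP[f fF /andP[zf fy]] /hasP[f' fF' /andP[yf' f'z]].
  by have := lt_trans (lt_le_trans zf (le_trans fy yf')) f'z; rewrite ltxx.
- move=> /hasP[f fF /andP[xf fz]] /hasP[f' fF' /andP[zf' f'y]].
  by apply: le_lt_trans xf (lt_le_trans (lt_trans fz zf') f'y).
Qed.

HB.instance Definition _ :=
  Order.Lt_isPOrder.Build d one_point_ext ext_lt_irr ext_lt_trans.

(* The point [z] is the free amalgam of [K] and the type of [z0] over [F]: its
   only relations to [K] are those forced by its relations to [F].  Homogeneity
   pulls it back from a universal embedding of the extended order. *)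
Lemma free_realization (K : seq D) : random_poset D ->
  exists z, [/\ z \notin K,
    forall k, k \in K -> (k < z) = has (fun f => (k <= f) && (f < z0)) F &
    forall k, k \in K -> (z < k) = has (fun f => (z0 < f) && (f <= k)) F].
Proof.
move=> [cD hom uni].
have [e [einj em]] : embeddable (strict_order one_point_ext) (strict_order D).
  apply: uni; have /countable_injP [h hinj] := cD.
  apply/countable_injP; exists (fun x : option D => if x is Some y then (h y).+1 else 0%N).
  move=> [x|] [y|] _ _ //= [hxy].
  by rewrite (hinj x y _ _ hxy) // inE.
have emE x y : (e x < e y) = ext_lt x y.
  by apply/idP/idP => xy; [have := (em x y).2 xy | have := (em x y).1 xy].
(* An automorphism extending [s] carries the embedded copy of [K] back to [K], and hence [e None] to
   the desired point. *)
pose s := [seq (e (Some k), k) | k <- K].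
have [p q /mapP[k _ ->] /mapP[k' _ ->]|g [h [gK hK gm gs]]] :=
    @homogeneous_extension _ D s hom.
  split => /=; first by apply/eqP/eqP => [/einj[]|->].
  exact: emE.
have gsk k : k \in K -> g (e (Some k)) = k.
  by move=> kK; apply: (gs (e (Some k), k)); apply/mapP; exists k.
exists (g (e None)); split.
- apply/negP => zK; have := gsk _ zK.
  by move=> /(can_inj gK)/einj.
- by move=> k kK; rewrite -{1}(gsk k kK) gm; apply/idP/idP => /(em (Some k) None).
- by move=> k kK; rewrite -{1}(gsk k kK) gm; apply/idP/idP => /(em None (Some k)).
Qed.

End OnePointExtension.

(** * Saturated subsets are copies; copies have no maximal elements *)

Section Saturated.
Local Open Scope order_scope.
Variables (d : Order.disp_t) (D : porderType d).

(** The point [z0] of [D] stands for the type that it realizes over [F]. *)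
Definition saturated (A : set D) := forall (F : seq D) (z0 : D),
  (forall f, f \in F -> A f) -> z0 \notin F ->
  exists z, [/\ A z, z \notin F &
    forall f, f \in F -> ((f < z) = (f < z0)) * ((z < f) = (z0 < f))].

Lemma local_iso_cons (x y : D) (s : seq (D * D)) : local_iso s ->
  x \notin unzip1 s -> y \notin unzip2 s ->
  (forall p, p \in s ->
     ((p.1 < x) = (p.2 < y)) * ((x < p.1) = (y < p.2))) ->
  local_iso ((x, y) :: s).
Proof.
move=> iso xs ys xy p q; rewrite !inE.
have nx r : r \in s -> (r.1 == x) = false.
  by move=> rs; apply/eqP => rx; move: xs; rewrite -rx map_f.
have ny r : r \in s -> (r.2 == y) = false.
  by move=> rs; apply/eqP => ry; move: ys; rewrite -ry map_f.
case/orP=> [/eqP->|ps] /orP[/eqP->|qs] /=.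
- by rewrite !eqxx !ltxx.
- by rewrite !(eq_sym _ q.1) !(eq_sym _ q.2) nx // ny // (xy q qs).2.
- by rewrite nx // ny // (xy p ps).1.
- exact: iso.
Qed.

(** Back and forth between [A] and [D], as a generic set of pairs: homogeneity gives one direction,
    and saturation brings the other back into [A]. *)
Lemma saturated_copy (A : set D) :
  countable [set: D] -> homogeneous D -> saturated A -> copies D A.
Proof.
move=> /countable_injP[c cinj] hom sat.
have {}cinj : injective c by move=> x y; apply: cinj; rewrite inE.
pose Q (j : D + D) := if j is inl a then A a else True.
pose f (j : D + D) : nat + nat :=
  match j with inl a => inl (c a) | inr b => inr (c b) end.
pose good (p : seq (D * D)) := local_iso p /\ forall q, q \in p -> A q.1.
pose E (j : D + D) (p : seq (D * D)) :=
  match j with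
  | inl a => exists b, (a, b) \in p
  | inr b => exists a, (a, b) \in p
  end.
have [| | |G [Gfin GE]] := @generic_set _ _ _ Q f good E.
- by move=> [x|x] [y|y] _ _ //= [/cinj->].
- by split.
- move=> [a|b] p /= Qj [iso Ap].
    have [/mapP[[x y] xyp /= ->]|ap] := boolP (a \in unzip1 p).
      by exists p; split=> //; exists y.
    have [g [h [gK hK gm gp]]] := homogeneous_extension hom iso.
    exists ((a, g a) :: p); split.
    + split; last by move=> q; rewrite inE => /orP[/eqP->|/Ap].
      apply: local_iso_cons => //.
        apply/negP => /mapP[q qp gaq]; move/negP: ap; apply.
        apply/mapP; exists q => //.
        by apply: (can_inj gK); rewrite gp.
      by move=> q qp; rewrite -(gp q qp) !gm.
    + by move=> q qp; rewrite inE qp orbT.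
    + by exists (g a); rewrite inE eqxx.
  have [/mapP[[x y] xyp /= ->]|bp] := boolP (b \in unzip2 p).
    by exists p; split=> //; exists x.
  have [g [h [gK hK gm gp]]] := homogeneous_extension hom iso.
  (* The preimage [h b] has the right type but may lie outside [A]; saturation replaces it by a
     point of [A]. *)
  have [||z [Az zp zF]] := sat (unzip1 p) (h b).
  + by move=> x /mapP[q /Ap Aq ->].
  + apply/negP => /mapP[q qp hq]; move/negP: bp; apply.
    by apply/mapP; exists q => //; rewrite -(gp q qp) -hq hK.
  exists ((z, b) :: p); split.
  + split; last by move=> q; rewrite inE => /orP[/eqP->|/Ap].
    apply: local_iso_cons => // q qp.
    have := zF q.1; rewrite map_f // => /(_ isT) [-> ->].
    by rewrite -!(gm _ (h b)) -!(gm (h b)) hK (gp q qp).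
  + by move=> q qp; rewrite inE qp orbT.
  + by exists z; rewrite inE eqxx.
have GA p : G p -> A p.1.
  move=> Gp; have [|q [_ Aq] [sq _]] := Gfin [:: p].
    by move=> x; rewrite inE => /eqP->.
  by apply/Aq/sq; rewrite inE eqxx.
have Giso p q : G p -> G q ->
    ((p.1 == q.1) = (p.2 == q.2)) * ((p.1 < q.1) = (p.2 < q.2)).
  move=> Gp Gq; have [|r [iso _] [sr _]] := Gfin [:: p; q].
    by move=> x; rewrite !inE => /orP[] /eqP->.
  by apply: iso; apply: sr; rewrite !inE eqxx ?orbT.
have phiP (x : A) : exists y, G (val x, y).
  have [p _ [[y yp] pG]] := GE (inl (val x)) (set_mem (valP x)).
  by exists y; apply: pG.
have psiP y : exists x : A, G (val x, y).
  have [p _ [[x xp] /(_ _ xp) Gxy]] := GE (inr y) I.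
  by exists (SigSub (mem_set (GA _ Gxy))).
have [phi {}phiP] := choice phiP; have [psi {}psiP] := choice psiP.
exists phi; split.
  exists psi => x; last first.
    by apply/eqP; have /= <- := (Giso _ _ (phiP (psi x)) (psiP x)).1.
  by apply/val_inj/eqP; have /= -> := (Giso _ _ (psiP (phi x)) (phiP x)).1.
by move=> x y; have /= := (Giso _ _ (phiP x) (phiP y)).2;
   rewrite /induced /strict_order => ->.
Qed.

(** By universality some point of [D] has a point above it, and homogeneity moves the former to any
    given point. *)
Lemma copy_no_maximum (A : set D) x : random_poset D -> copies D A -> A x ->
  exists2 y, A y & x < y.
Proof.
move=> [_ hom uni] [f [[g fK gK] fm]] Ax.
have [e [_ em]] : embeddable (strict_order bool) (strict_order D).
  by apply: uni; exact: countableP.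
pose a : A := SigSub (mem_set Ax).
have [|h [h' [_ hK hm hs]]] := @homogeneous_extension _ D [:: (e false, f a)] hom.
  by move=> p q; rewrite !inE => /eqP-> /eqP->; rewrite !eqxx !ltxx.
exists (val (g (h (e true)))); first exact: set_mem (valP _).
suff : strict_order D (f a) (f (g (h (e true)))) by move=> /fm.
have /= <- := hs _ (mem_head _ _).
by rewrite gK /strict_order hm; apply/(em false true).
Qed.

End Saturated.

(** * Countable sets of levels in the linear order *)

Section Levels.
Local Open Scope order_scope.
Variables (d : Order.disp_t) (L : tbOrderType d).

Definition is_succ (y : L) := exists x, immediate_succ x y.

(** This holds vacuously of [\top], hence the separate condition [s < \top] in [level_set]. *)
Definition right_limit (x : L) := forall y, x < y -> exists2 z, x < z & z < y.

(** The alternative [s = y] in the density clause covers jumps, where no level lies strictly between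
    [x] and [y]. *)
Definition level_set (S : set L) :=
  [/\ countable S, is_succ `<=` S,
    forall s, S s -> \bot < s /\ (is_succ s \/ right_limit s /\ s < \top) &
    forall x y, x < y ->
      exists2 s, S s & x < s /\ (s < y \/ s = y /\ is_succ s)].

Lemma right_limitNsucc x y : right_limit x -> ~ immediate_succ x y.
Proof. by move=> lx [xy no]; have [z xz zy] := lx y xy; apply: (no z). Qed.

(** A rational inside the image of a jump determines the jump, so there are countably many immediate
    successors. For density, one element of [G] is picked from each rational interval that meets the
    image of [G]. *)
Lemma level_set_exists (R : realType) :
  embeddable (strict_order L) (strict_order R) -> exists S, level_set S.
Proof.
move=> [e [_ em]].
have emE x y : (e x < e y) = (x < y).
  by apply/idP/idP => xy; [have := (em x y).2 xy | have := (em x y).1 xy].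
pose G := [set s | \bot < s /\ (is_succ s \/ right_limit s /\ s < \top)].
(* The default [\bot] is not in [G], so intersecting the range of [h] with [G] discards it. *)
pose h (j : rat + rat * rat) : L :=
  match j with
  | inl q => xget \bot
      [set s | exists2 t, immediate_succ t s & e t < ratr q < e s]
  | inr (p, q) => xget \bot [set s | G s /\ ratr p < e s < ratr q]
  end.
have succG s : is_succ s -> G s.
  move=> ss; split; last by left.
  by have [t [ts _]] := ss; apply: le_lt_trans (le0x _) ts.
have succh s : is_succ s -> exists q, h (inl q) = s.
  move=> [t ts].
  have [q] : exists q : rat, ratr q \in `]e t, e s[.
    by apply: rat_in_itvoo; rewrite emE ts.1.
  rewrite in_itv /= => /andP[tq qs]; exists q; pose s' := h (inl q); change (s' = s).
  have [t' [t's' no'] /andP[t'q qs']] :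
      exists2 t, immediate_succ t s' & e t < ratr q < e s'.
    apply: (@xgetPex L \bot
      [set s | exists2 t, immediate_succ t s & e t < ratr q < e s]).
    by exists s; exists t => //; rewrite tq.
  (* Two jumps over the same rational overlap, so if [s] and [s'] differed, the smaller would lie
     strictly inside the other jump. *)
  have t's := lt_trans t'q qs; have ts' := lt_trans tq qs'; rewrite !emE in t's ts'.
  apply/eqP; rewrite eq_le !leNgt; apply/andP; split; apply/negP => ss'.
    by apply: (no' s).
  by apply: (ts.2 s').
exists (G `&` range h)%classic; split.
- apply: (@sub_countable _ _ _ [set: rat + rat * rat]); last exact: countableP.
  apply: card_le_trans (card_image_le h setT); apply: subset_card_le.
  by apply: subIsetr.
- move=> s ss; split; first exact: succG.
  by have [q <-] := succh s ss; exists (inl q).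
- by move=> s [].
- move=> x y xy.
  have [[s [ss xs sy]]|nsucc] :=
      pselect (exists s, [/\ is_succ s, x < s & s <= y]).
    exists s.
      split; first exact: succG.
      by have [q <-] := succh s ss; exists (inl q).
    by split=> //; move: sy; rewrite le_eqVlt => /orP[/eqP sy|sy]; [right|left].
  (* Without immediate successors above [x] and up to [y], the interval is densely ordered and its
     interior points are right limits. *)
  have dense u v : x <= u -> u < v -> v <= y -> exists2 z, u < z & z < v.
    move=> xu uv vy; apply: contrapT => no; apply: nsucc.
    exists v; split=> //; last exact: le_lt_trans xu uv.
    by exists u; split=> // z [uz zv]; apply: no; exists z.
  have [u xu uy] := dense x y (lexx x) xy (lexx y).
  have Gu : G u.
    split; first exact: le_lt_trans (le0x x) xu.
    right; split; last exact: lt_le_trans uy (lex1 y).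
    move=> v uv; have [z uz zv] : exists2 z, u < z & z < Order.min v y.
      apply: dense (ltW xu) _ _; first by rewrite lt_min uv uy.
      by rewrite ge_min lexx orbT.
    by exists z => //; move: zv; rewrite lt_min => /andP[].
  have [p] : exists q : rat, ratr q \in `]e x, e u[.
    by apply: rat_in_itvoo; rewrite emE.
  rewrite in_itv /= => /andP[xp pu].
  have [q] : exists q : rat, ratr q \in `]e u, e y[.
    by apply: rat_in_itvoo; rewrite emE.
  rewrite in_itv /= => /andP[uq qy].
  have [|Gt /andP[pt tq]] := @xgetPex L \bot
      [set s | G s /\ ratr p < e s < ratr q].
    by exists u; split=> //; rewrite pu uq.
  exists (h (inr (p, q))); first by split=> //; exists (inr (p, q)).
  split; first by rewrite -emE; apply: lt_trans xp pt.
  by left; rewrite -emE; apply: lt_trans tq qy.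
Qed.

Lemma right_limit_bot : bot_non_isolated L -> right_limit \bot.
Proof.
move=> [_ no] y y0; apply: contrapT => noz; apply: no.
by exists y; split=> // z [z0 zy]; apply: noz; exists z.
Qed.

Lemma level_set_fresh (S : set L) (m x : L) (U : seq L) :
  level_set S -> right_limit m -> m < x ->
  exists s, [/\ S s, m < s, s < x & s \notin U].
Proof.
move=> [_ _ _ dense] lm mx.
(* No member of [U] lies strictly between [m] and [y], so any level found there is fresh. *)
have [y [my yx yU]] : exists y, [/\ m < y, y <= x &
    forall u, u \in U -> m < u -> y <= u].
  elim: U => [|u U [y [my yx yU]]]; first by exists x.
  have [mu|um] := boolP (m < u).
    exists (Order.min u y); split; first by rewrite lt_min mu.
      by rewrite ge_min yx orbT.
    move=> v; rewrite inE ge_min => /orP[/eqP->|vU] mv; first by rewrite lexx.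
    by rewrite yU ?orbT.
  exists y; split=> // v; rewrite inE => /orP[/eqP->|/yU//].
  by rewrite (negbTE um).
(* The density clause may return the right end of its interval; aiming at [z] keeps the level
   strictly below [y]. *)
have [z mz zy] := lm y my; have [s Ss [ms sz]] := dense m z mz.
have sy : s < y by case: sz => [/lt_trans->|[-> _]].
exists s; split=> //; first exact: lt_le_trans sy yx.
by apply/negP => /yU/(_ ms); rewrite leNgt sy.
Qed.

(** The down-closure of [Y] and its complement do not form a gap: a maximum of the former or a
    minimum of the latter is the supremum. If the complement is empty, [\top] is that maximum. *)
Lemma complete_lub (Y : set L) : complete_order L -> Y !=set0 ->
  exists x, (forall y, Y y -> y <= x) /\
    forall z, (forall y, Y y -> y <= z) -> x <= z.
Proof.
move=> cL [y0 Yy0].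
pose A := [set a | exists2 y, Y y & a <= y].
have AB : (A `|` ~` A = setT)%classic by rewrite setUv.
have YA y : Y y -> A y by move=> Yy; exists y.
have lubA m : A m -> (forall a, A a -> a <= m) ->
    exists x, (forall y, Y y -> y <= x) /\
    forall z, (forall y, Y y -> y <= z) -> x <= z.
  move=> [y Yy my] mA; exists m; split=> [y' /YA/mA//|z /(_ y Yy)].
  exact: le_trans.
have [[b nAb]|noB] := pselect ((~` A) !=set0)%classic; last first.
  apply: (lubA \top) => [|a _]; last exact: lex1.
  by apply: contrapT => nA; apply: noB; exists \top.
have Alt a b' : A a -> ~ A b' -> a < b'.
  move=> [y Yy ay] nAb'; rewrite ltNge; apply/negP => b'a; apply: nAb'.
  by exists y => //; apply: le_trans b'a ay.
have [[m Am mA]|noA] := pselect (exists2 m, A m & forall a, A a -> a <= m).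
  exact: lubA Am mA.
have [[m nAm mB]|noB] := pselect (exists2 m, ~ A m & forall b, ~ A b -> m <= b).
  exists m; split=> [y /YA Ay|z zY]; first exact/ltW/Alt.
  have [Az|] := pselect (A z); last exact: mB.
  exfalso; apply: noA; exists z => // a [y Yy ay]; exact: le_trans ay (zY y Yy).
exfalso; apply: (cL A (~` A)%classic); split=> //.
by split; [exists y0; apply: YA | exists b].
Qed.

End Levels.

(** * Finite approximations of the rank and the generic rank *)

Section Rank.
Local Open Scope order_scope.
Variables (dD : Order.disp_t) (D : porderType dD).
Variables (dL : Order.disp_t) (L : tbOrderType dL).
Variable S : set L.
Hypotheses (hD : random_poset D) (hL0 : bot_non_isolated L) (hS : level_set S).

(* The second disjunct puts a point ranked at an immediate successor [x] already
   into the cut at [x], so that the chain has a jump there. *)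
Definition below (v x : L) := v < x \/ v = x /\ is_succ x.

(** The equality of the two tests makes the list the graph of an injective partial function.
    Exempting successor levels lets the point of rank [y] in the cut at an immediate successor [y]
    lie below points of smaller rank, so that it is not maximal there. *)
Definition rank_good (p : seq (D * L)) := (forall q, q \in p -> S q.2) /\
  forall q r, q \in p -> r \in p -> (q.1 == r.1) = (q.2 == r.2) /\
    (q.1 < r.1 -> ~ is_succ q.2 -> q.2 < r.2).

Lemma rank_good_cons x s p : rank_good p -> S s ->
  x \notin unzip1 p -> s \notin unzip2 p ->
  (forall q, q \in p -> q.1 < x -> ~ is_succ q.2 -> q.2 < s) ->
  (forall q, q \in p -> x < q.1 -> ~ is_succ s -> s < q.2) ->
  rank_good ((x, s) :: p).
Proof.
move=> [Sp gp] Ss xp sp lo up; split.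
  by move=> q; rewrite inE => /orP[/eqP->|/Sp].
have nx r : r \in p -> (r.1 == x) = false.
  by move=> rp; apply/eqP => rx; move: xp; rewrite -rx map_f.
have ns r : r \in p -> (r.2 == s) = false.
  by move=> rp; apply/eqP => rs; move: sp; rewrite -rs map_f.
move=> q r; rewrite !inE => /orP[/eqP->|qp] /orP[/eqP->|rp] /=.
- by rewrite !eqxx ltxx.
- by rewrite !(eq_sym _ r.1) !(eq_sym _ r.2) nx // ns //; split=> //; apply: up.
- by rewrite nx // ns //; split=> //; apply: lo.
- exact: gp.
Qed.

(** Let [m] be the largest non-successor level of a point below [x], or [\bot]. It is a right limit,
    below [y] and below the levels of all points above [x]; a fresh level just above [m] fits. *)
Lemma rank_good_add x y p : rank_good p -> x \notin unzip1 p -> \bot < y ->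
  (forall q, q \in p -> q.1 < x -> ~ is_succ q.2 -> q.2 < y) ->
  exists2 s, s < y & rank_good ((x, s) :: p).
Proof.
move=> gp xp y0 py; have [Sp rp] := gp; have [_ _ SP _] := hS.
have [m [lm mp my mu]] : exists m, [/\ right_limit m,
    forall q, q \in p -> q.1 < x -> ~ is_succ q.2 -> q.2 <= m,
    m < y & forall u, u \in p -> x < u.1 -> m < u.2].
  (* The induction runs over a list contained in [p], while the bound on points above [x] still
     concerns all of [p]. *)
  have : {subset p <= p} by [].
  elim: {1 3}p => [_|q s IH sp].
    exists \bot; split=> //; first exact: right_limit_bot.
    by move=> u /Sp/SP[].
  have qp : q \in p by apply: sp; rewrite inE eqxx.
  have [r rs|m [lm ms my mu]] := IH; first by apply: sp; rewrite inE rs orbT.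
  have [[qx nq]|nqx] := pselect (q.1 < x /\ ~ is_succ q.2).
    exists (Order.max m q.2); split.
    - have lq : right_limit q.2 by have [_ [|[]]] := SP _ (Sp q qp).
      by case: leP.
    - move=> r; rewrite inE le_max => /orP[/eqP->|rs] rx nr.
        by rewrite lexx orbT.
      by rewrite ms.
    - by rewrite gt_max my py.
    - move=> u up xu; rewrite gt_max mu //.
      exact: (rp q u qp up).2 (lt_trans qx xu) nq.
  exists m; split=> // r; rewrite inE => /orP[/eqP->|]; last exact: ms.
  by move=> qx nq; exfalso; apply: nqx.
have [y' [my' yy' yu]] : exists y', [/\ m < y', y' <= y &
    forall u, u \in p -> x < u.1 -> y' <= u.2].
  have : {subset p <= p} by [].
  elim: {1 3}p => [_|q s IH sp]; first by exists y.
  have qp : q \in p by apply: sp; rewrite inE eqxx.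
  have [r rs|y' [my' yy' ys]] := IH; first by apply: sp; rewrite inE rs orbT.
  have [xq|nxq] := boolP (x < q.1).
    exists (Order.min y' q.2); split; first by rewrite lt_min my' mu.
      by rewrite ge_min yy'.
    move=> u; rewrite inE ge_min => /orP[/eqP->|us] xu; first by rewrite lexx orbT.
    by rewrite ys.
  exists y'; split=> // u; rewrite inE => /orP[/eqP->|/ys//].
  by rewrite (negbTE nxq).
have [s [Ss ms sy sp]] := level_set_fresh (unzip2 p) hS lm my'.
exists s; first exact: lt_le_trans sy yy'.
apply: rank_good_cons => // q qp.
  by move=> qx nq; apply: le_lt_trans ms; apply: mp.
by move=> xq _; apply: lt_le_trans sy _; apply: yu.
Qed.

Lemma rank_good_dom (F : seq D) p : rank_good p ->
  exists q, [/\ rank_good q, {subset p <= q} &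
    forall f, f \in F -> exists v, (f, v) \in q].
Proof.
move=> gp; elim: F => [|x F [q [gq pq Fq]]]; first by exists p; split.
have [/mapP[[y v] yvq /= ->]|xq] := boolP (x \in unzip1 q).
  exists q; split=> // f; rewrite inE => /orP[/eqP->|/Fq//].
  by exists v.
have [_ _ SP _] := hS.
(* The bound [\top] is admissible because non-successor levels in [S] lie strictly below it. *)
have [||s _ gs] := @rank_good_add x \top q gq xq.
- by have [[z z0] _] := hL0; apply: lt_le_trans z0 (lex1 z).
- by move=> r /gq.1/SP[_ [//|[_ ->]]].
exists ((x, s) :: q); split=> //.
  by move=> r /pq rq; rewrite inE rq orbT.
move=> f; rewrite inE => /orP[/eqP->|/Fq[v fv]].
  by exists s; rewrite inE eqxx.
by exists v; rewrite inE fv orbT.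
Qed.

Lemma rank_good_realize (F : seq D) z0 y p : rank_good p -> \bot < y ->
  (forall f, f \in F -> exists2 v, (f, v) \in p & below v y) -> z0 \notin F ->
  exists z s, [/\ rank_good ((z, s) :: p), s < y, z \notin F &
    forall f, f \in F -> ((f < z) = (f < z0)) * ((z < f) = (z0 < f))].
Proof.
move=> gp y0 Fp z0F.
have [z [zp lo up]] := @free_realization _ _ F z0 (unzip1 p) hD.
have F1 f : f \in F -> f \in unzip1 p.
  by move=> /Fp[v fv _]; apply/mapP; exists (f, v).
have [|s sy gs] := @rank_good_add z y p gp zp y0.
  (* By freeness a point below [z] is at or below some [f] in [F]. A non-successor level there is
     strictly below [y]: through the level of [f] if the points differ, and by [below] if they
     coincide. *)
  move=> q qp qz nq; move: (qz); rewrite lo ?map_f // => /hasP[f fF /andP[qf _]].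
  have [v fv vy] := Fp f fF; have [qfv qfvlt] := gp.2 _ _ qp fv.
  move: qf; rewrite le_eqVlt => /orP[|qf].
    rewrite -[_ == _]/(q.1 == (f, v).1) qfv => /eqP /= qv.
    by case: vy => [|[vy sy]]; rewrite qv //; case: nq; rewrite qv vy.
  have vy' : v <= y by case: vy => [/ltW|[->]].
  exact: lt_le_trans (qfvlt qf nq) vy'.
exists z, s; split=> //; first by apply: contra zp => /F1.
move=> f fF; rewrite lo ?F1 // up ?F1 //; split; apply/hasP/idP.
- by move=> [f' _ /andP[/le_lt_trans]]; apply.
- by move=> fz; exists f => //; rewrite lexx.
- by move=> [f' _ /andP[/lt_le_trans]]; apply.
- by move=> fz; exists f => //; rewrite lexx andbT.
Qed.

Lemma rank_good_onto s p : S s -> rank_good p ->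
  exists q, [/\ rank_good q, {subset p <= q} & exists x, (x, s) \in q].
Proof.
move=> Ss gp; have [/mapP[[x v] xvp /= ->]|sp] := boolP (s \in unzip2 p).
  by exists p; split=> //; exists x.
have [_ _ uni] := hD.
have [e _] : embeddable (strict_order bool) (strict_order D).
  by apply: uni; exact: countableP.
have [z [zp lo up]] := @free_realization _ _ [::] (e true) (unzip1 p) hD.
exists ((z, s) :: p); split.
- by apply: rank_good_cons => // q qp; rewrite ?lo ?up // map_f.
- by move=> q qp; rewrite inE qp orbT.
- by exists z; rewrite inE eqxx.
Qed.

Lemma rank_exists : exists rho : D -> L,
  [/\ forall x, S (rho x), injective rho, forall s, S s -> exists x, rho x = s,
    forall x y, x < y -> ~ is_succ (rho x) -> rho x < rho y &
    forall (F : seq D) z0 y, S y -> z0 \notin F ->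
      (forall f, f \in F -> below (rho f) y) ->
      exists z, [/\ rho z < y, z \notin F &
        forall f, f \in F -> ((f < z) = (f < z0)) * ((z < f) = (z0 < f))]].
Proof.
have [/countable_injP[c cinj] _ _] := hD.
have {}cinj : injective c by move=> x y; apply: cinj; rewrite inE.
have [/countable_injP[l linj] _ SP _] := hS.
pose Q (j : D + L + seq D * D * L) :=
  match j with
  | inl (inl _) => True
  | inl (inr s) => S s
  | inr (F, z0, y) => S y /\ z0 \notin F
  end.
pose f (j : D + L + seq D * D * L) : nat + nat + seq nat * nat * nat :=
  match j with
  | inl (inl x) => inl (inl (c x))
  | inl (inr s) => inl (inr (l s))
  | inr (F, z0, y) => inr (map c F, c z0, l y)
  end.
pose type (F : seq D) (z z0 : D) :=
  forall f, f \in F -> ((f < z) = (f < z0)) * ((z < f) = (z0 < f)).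
pose E (j : D + L + seq D * D * L) (p : seq (D * L)) :=
  match j with
  | inl (inl x) => exists s, (x, s) \in p
  | inl (inr s) => exists x, (x, s) \in p
  | inr (F, z0, y) => (forall f, f \in F -> exists2 v, (f, v) \in p & below v y) ->
      exists z v, [/\ (z, v) \in p, v < y, z \notin F & type F z z0]
  end.
(* A type requirement is an implication about the levels that [p] gives to [F]. Forcing [F] into the
   domain of [p] ensures that it is not met just because these levels are still undecided. *)
have [| | |G [Gfin GE]] := @generic_set _ _ _ Q f rank_good
    (fun j p =>
       (if j is inr (F, _, _) then forall x, x \in F -> exists v, (x, v) \in p
        else True) /\ E j p).
- move=> [[x|s]|[[F x] s]] [[x'|s']|[[F' x'] s']]; rewrite !inE //=.
  + by move=> _ _ [/cinj->].
  + by move=> Ss Ss' [/linj->] //; rewrite inE.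
  + move=> [Ss _] [Ss' _] [/(inj_map cinj)-> /cinj-> /linj->] //; by rewrite inE.
- by split.
- move=> [[x|s]|[[F z0] y]] p /= Qj gp.
  + have [q [gq pq xq]] := rank_good_dom [:: x] gp.
    by exists q; split=> //; split=> //; apply: xq; rewrite inE.
  + by have [q [gq pq xq]] := rank_good_onto Qj gp; exists q.
  + have [q [gq pq Fq]] := rank_good_dom F gp.
    have [Fy|nFy] := pselect (forall f, f \in F -> exists2 v, (f, v) \in q & below v y);
      last by exists q.
    have [z [s [gs sy zF zt]]] := rank_good_realize gq (SP _ Qj.1).1 Fy Qj.2.
    have qs r : r \in q -> r \in (z, s) :: q by rewrite inE orbC => ->.
    exists ((z, s) :: q); split=> //; first by move=> r /pq/qs.
    split; first by move=> f' /Fq[v /qs]; exists v.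
    by move=> _; exists z, s; split=> //; rewrite inE eqxx.
(* Any two pairs of [G] lie in a common good approximation. *)
have G2 q r : G q -> G r -> [/\ S q.2, (q.1 == r.1) = (q.2 == r.2) &
    (q.1 < r.1 -> ~ is_succ q.2 -> q.2 < r.2)].
  move=> Gq Gr; have [|p [Sp gp] [qr _]] := Gfin [:: q; r].
    by move=> x; rewrite !inE => /orP[] /eqP->.
  have qp : q \in p by apply: qr; rewrite inE eqxx.
  have rp : r \in p by apply: qr; rewrite !inE eqxx orbT.
  by have [] := gp q r qp rp; split=> //; apply: Sp.
have rhoP x : exists s, G (x, s).
  by have [p _ [[_ [s xs]] /(_ _ xs) Gx]] := GE (inl (inl x)) I; exists s.
have [rho {}rhoP] := choice rhoP.
have rhoE x s : G (x, s) -> rho x = s.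
  by move=> Gx; have [_ /= + _] := G2 _ _ (rhoP x) Gx; rewrite eqxx => /esym/eqP.
exists rho; split.
- by move=> x; have [] := G2 _ _ (rhoP x) (rhoP x).
- move=> x y xy; have [_ /= + _] := G2 _ _ (rhoP x) (rhoP y).
  by rewrite xy eqxx => /eqP.
- move=> s Ss; have [p _ [[_ [x xs]] /(_ _ xs) Gx]] := GE (inl (inr s)) Ss.
  by exists x; apply: rhoE.
- by move=> x y xy; have [_ _] := G2 _ _ (rhoP x) (rhoP y); apply.
move=> F z0 y Sy z0F Fy.
have [p gp [[Fp Ep] pG]] := GE (inr (F, z0, y)) (conj Sy z0F).
have [|z [v [zv vy zF zt]]] := Ep.
  move=> f' fF; have [v fv] := Fp _ fF; exists v => //.
  by rewrite -(rhoE _ _ (pG _ fv)); apply: Fy.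
by exists z; split=> //; rewrite (rhoE _ _ (pG _ zv)).
Qed.

End Rank.

(** * The chain of cuts and its maximality *)

Section Chain.
Local Open Scope order_scope.
Variables (dD : Order.disp_t) (D : porderType dD).
Variables (dL : Order.disp_t) (L : tbOrderType dL).
Variables (S : set L) (rho : D -> L).
Hypotheses (hD : random_poset D) (hLc : complete_order L).
Hypotheses (hL0 : bot_non_isolated L) (hS : level_set S).
Hypotheses (rhoS : forall x, S (rho x)) (rho_inj : injective rho).
Hypothesis rho_onto : forall s, S s -> exists x, rho x = s.
Hypothesis rho_lt : forall x y, x < y -> ~ is_succ (rho x) -> rho x < rho y.
Hypothesis rho_type : forall (F : seq D) z0 y, S y -> z0 \notin F ->
  (forall f, f \in F -> below (rho f) y) ->
  exists z, [/\ rho z < y, z \notin F &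
    forall f, f \in F -> ((f < z) = (f < z0)) * ((z < f) = (z0 < f))].

Definition cut (x : L) : set D := [set a | below (rho a) x].

Lemma below_le (v x : L) : below v x -> v <= x.
Proof. by case=> [/ltW|[->]]. Qed.

Lemma cut_le x y : x <= y -> (cut x `<=` cut y)%classic.
Proof.
rewrite le_eqVlt => /orP[/eqP->//|xy] a /below_le ax.
by left; apply: le_lt_trans ax xy.
Qed.

Lemma cut_lt x y : x < y -> exists2 a, cut y a & ~ cut x a.
Proof.
have [_ _ _ dense] := hS.
move=> /dense[s Ss [xs sy]]; have [a rs] := rho_onto Ss.
exists a; first by rewrite /cut /= rs; case: sy => [|[-> ?]]; [left|right].
by move=> /below_le; rewrite rs leNgt xs.
Qed.

Lemma cut_bot : cut \bot = set0.
Proof.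
have [_ _ SP _] := hS.
apply/seteqP; split=> // a /below_le.
by rewrite leNgt; have [-> _] := SP _ (rhoS a).
Qed.

Lemma cut_saturated x : \bot < x -> saturated (cut x).
Proof.
move=> x0 F z0 FA z0F; have [_ succS _ dense] := hS.
suff [y [Sy yx Fy]] : exists y, [/\ S y, y <= x &
    forall f, f \in F -> below (rho f) y].
  have [z [zy zF zt]] := rho_type Sy z0F Fy.
  by exists z; split=> //; left; apply: lt_le_trans zy yx.
(* If [x] is not in [S], it is not an immediate successor, so the finitely many ranks of [F] lie
   strictly below [x] and a level of [S] fits above them. *)
have [Sx|nSx] := pselect (S x); first by exists x.
have [m mx Fm] : exists2 m, m < x & forall f, f \in F -> rho f <= m.
  elim: F FA {z0F} => [|a F IH] FA; first by exists \bot.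
  have [|m mx Fm] := IH; first by move=> f fF; apply: FA; rewrite inE fF orbT.
  exists (Order.max m (rho a)).
    rewrite gt_max mx.
    by have [|//|[_ /succS]] := FA a; first by rewrite inE eqxx.
  move=> f; rewrite inE le_max => /orP[/eqP->|/Fm->//].
  by rewrite lexx orbT.
have [s Ss [ms sx]] := dense m x mx.
exists s; split=> //; first by case: sx => [/ltW|[->]].
by move=> f /Fm fm; left; apply: le_lt_trans fm ms.
Qed.

Lemma cut_copy x : \bot < x -> copies D (cut x).
Proof.
have [cD hom _] := hD.
by move=> x0; apply: saturated_copy => //; apply: cut_saturated.
Qed.

Lemma cut_comparable_copy (X : set D) : copies D X ->
  (forall x, (cut x `<=` X)%classic \/ (X `<=` cut x)%classic) ->
  exists x, X = cut x.
Proof.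
move=> cX comp; have [_ _ SP _] := hS.
(* The candidate is the supremum of the levels whose cut is contained in [X]. *)
have [|x [xub xlub]] := @complete_lub _ _ [set y | (cut y `<=` X)%classic] hLc.
  by exists \bot; rewrite /= cut_bot; apply: sub0set.
have xX : (cut x `<=` X)%classic.
  have limY t : t < x -> exists2 y, t < y & (cut y `<=` X)%classic.
    move=> tx; apply: contrapT => no.
    have /xlub : forall y, (cut y `<=` X)%classic -> y <= t.
      by move=> y yX; rewrite leNgt; apply/negP => ty; apply: no; exists y.
    by rewrite leNgt tx.
  (* A rank strictly below the supremum lies below some level whose cut is in [X]. A rank equal to
     [x] occurs only for a successor [x], and then the supremum is attained. *)
  move=> a [ax|[ax [t [tx no]]]].
    by have [y ay yX] := limY _ ax; apply: yX; left.
  have [y ty yX] := limY t tx; apply: (yX).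
  have := xub y yX; rewrite le_eqVlt => /orP[/eqP->|yx]; last by case: (no y).
  by right; split=> //; exists t.
have Xy y : x < y -> (X `<=` cut y)%classic.
  by move=> xy; case: (comp y) => // yX; have := xub y yX; rewrite leNgt xy.
have [Xx|nXx] := pselect (X `<=` cut x)%classic.
  by exists x; apply/seteqP.
have [p Xp nxp] : exists2 p, X p & ~ cut x p.
  apply: contrapT => no; apply: nXx => a Xa; apply: contrapT => na.
  by apply: no; exists a.
have : x <= rho p by rewrite leNgt; apply/negP => px; apply: nxp; left.
rewrite le_eqVlt => /orP[/eqP xp|xp].
  have np : ~ is_succ (rho p) by move=> sp; apply: nxp; right; rewrite xp.
  have lp : right_limit (rho p) by have [_ [|[]]] := SP _ (rhoS p).
  (* A point [q] of [X] above [p] has rank greater than [x], yet [X] is contained in every cut above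
     [x]. *)
  have [q Xq pq] := copy_no_maximum hD cX Xp.
  have [z pz zq] := lp _ (rho_lt pq np).
  have xz : x < z by rewrite xp.
  by have /below_le := Xy z xz q Xq; rewrite leNgt zq.
have xsp : immediate_succ x (rho p).
  split=> // z [xz zp].
  by have /below_le := Xy z xz p Xp; rewrite leNgt zp.
(* Injectivity makes [p] the only point of rank [rho p]. A point of rank exactly [x] has a successor
   rank, since [x] has an immediate successor and so is no right limit. *)
exists (rho p); apply/seteqP; split; first exact: Xy.
move=> a [ap|[/rho_inj-> //]].
apply: xX; have : rho a <= x.
  by rewrite leNgt; apply/negP => xa; apply: (xsp.2 (rho a)).
rewrite le_eqVlt => /orP[/eqP ax|]; last by left.
right; split=> //; rewrite -ax.
have [_ [//|[lx _]]] := SP _ (rhoS a).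
by case: (@right_limitNsucc _ L (rho a) (rho p) lx); rewrite ax.
Qed.

(** A larger chain adds only sets comparable with every cut; the copies among them are cuts by
    [cut_comparable_copy], and the empty set is the cut at [\bot]. *)
Lemma cut_maximal_chain :
  is_maximal_chain (copies D `|` [set set0])%classic (range cut).
Proof.
split.
  split; first move=> _ [x _ <-].
    have : \bot <= x by apply: le0x.
    rewrite le_eqVlt => /orP[/eqP<-|/cut_copy]; last by left.
    by right; rewrite /= cut_bot.
  move=> _ _ [x _ <-] [y _ <-].
  by have /orP[xy|yx] := le_total x y; [left|right]; apply: cut_le.
move=> C' [C'P C'tot] CC'; apply/seteqP; split=> // X C'X.
have [cX|->] := C'P X C'X; last by exists \bot => //; exact: cut_bot.
have [x ->] : exists x, X = cut x; last by exists x.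
apply: cut_comparable_copy => // x; apply: C'tot => //.
by apply: CC'; exists x.
Qed.

Lemma cut_isomorphic :
  isomorphic (strict_order L) (induced (@proper D) (range cut)).
Proof.
have ltP x y : x < y <-> (cut x `<` cut y)%classic.
  split=> [xy|[_ yx]].
    split; first exact/cut_le/ltW.
    by move=> yx; have [a ya nxa] := cut_lt xy; apply/nxa/yx.
  by rewrite ltNge; apply/negP => /cut_le.
have inC x : cut x \in range cut by rewrite inE; exists x.
have psiP (X : range cut) : exists x, cut x = val X.
  by have [x _ <-] := set_mem (valP X); exists x.
have [psi {}psiP] := choice psiP.
have cut_inj : injective cut.
  move=> x y xy; apply/eqP; rewrite eq_le !leNgt.
  by apply/andP; split; apply/negP => /ltP; rewrite xy => -[_]; apply.
exists (fun x => SigSub (inC x)); split=> [|x y]; last exact: ltP.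
exists psi => [x|X]; first by apply: cut_inj; rewrite psiP.
by apply: val_inj; rewrite /= psiP.
Qed.

End Chain.

Theorem theorem4p1 (R : realType)
    (dD : Order.disp_t) (D : porderType dD) (hD : random_poset D)
    (dL : Order.disp_t) (L : tbOrderType dL)
    (hLR : embeddable (strict_order L) (strict_order R))
    (hLc : complete_order L)
    (hL0 : bot_non_isolated L) :
  exists2 C : set (set D),
    is_maximal_chain (copies D `|` [set set0]) C &
    isomorphic (strict_order L) (induced (@proper D) C).
Proof.
have [S hS] := level_set_exists hLR.
have [rho [rhoS rho_inj rho_onto rho_lt rho_type]] := rank_exists hD hL0 hS.
exists (range (cut rho)).
  exact: (cut_maximal_chain hD hLc hS).
exact: (cut_isomorphic hS).
Qed.
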